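(* Let $n\geq 2$ and let $(D,\mathbf r)$ be any harmonic structure on the level-$n$ Sierpinski gasket $\mathcal{SG}_n$. Then $(D,\mathbf r)$ is non-degenerate; that is, if $h:\mathcal{SG}_n\to\mathbb R$ is a nonconstant harmonic function (with respect to $(D,\mathbf r)$), then $h$ is not constant on any cell $F_{w}\mathcal{SG}_n$, $w$ a finite word.
   Context: Level-$n$ Sierpinski gasket. Let $q_0,q_1,q_2\in\mathbb R^2$ be the vertices of an equilateral triangle, $V_0=\{q_0,q_1,q_2\}$ (the boundary), and $n\geq 2$. Put $N=\frac{n^2+n-2}{2}$, and let $F_0,\dots,F_N$ be an enumeration of the $N+1=\frac{n(n+1)}2$ contractions $z\mapsto n^{-1}z+n^{-1}(aq_0+bq_1+cq_2)$ of $\mathbb R^2$, where $a,b,c$ range over non-negative integers with $a+b+c=n-1$. $\mathcal{SG}_n$ is the unique nonempty compact set with $\mathcal{SG}_n=\bigcup_{i=0}^{N}F_i\mathcal{SG}_n$. For a finite word $w=w_1\cdots w_m$ with letters in $\{0,\dots,N\}$ put $F_w=F_{w_1}\circ\cdots\circ F_{w_m}$; the sets $F_w\mathcal{SG}_n$ are called cells. Put $V_m=\bigcup_{|w|=m}F_wV_0$; in particular $V_1=\bigcup_{i=0}^N F_iV_0$. Laplacians on finite sets. For a finite set $V$ let $l(V)$ be the space of real functions on $V$. A symmetric linear operator (matrix) $H:l(V)\to l(V)$ is a Laplacian on $V$ if (1) $H$ is non-positive definite, (2) $Hu=0$ if and only if $u$ is constant on $V$, (3) $H_{pq}\geq 0$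 for all $p\neq q$. The set of Laplacians on $V$ is denoted $\mathcal{LA}(V)$. Harmonic structures. Let $D\in\mathcal{LA}(V_0)$ and $\mathbf r=(r_0,\dots,r_N)$ with all $r_i>0$. Put $\mathcal E_0(u,v)=\sum_{p,q\in V_0}D_{pq}(u(p)-u(q))(v(p)-v(q))$ for $u,v\in l(V_0)$, and $\mathcal E_1(u,v)=\sum_{i=0}^N r_i^{-1}\mathcal E_0(u\circ F_i,v\circ F_i)$ for $u,v\in l(V_1)$. The pair $(D,\mathbf r)$ is a harmonic structure on $\mathcal{SG}_n$ if the restriction (trace) of $\mathcal E_1$ to $V_0$ equals $\mathcal E_0$, i.e. $\mathcal E_0(u,u)=\min\{\mathcal E_1(v,v): v\in l(V_1),\ v|_{V_0}=u\}$ for all $u\in l(V_0)$. Harmonic functions. For $m\ge 1$ let $H_m=\sum_{|w|=m}r_w^{-1}R_w^tDR_w$, a Laplacian on $V_m$, where $r_w=r_{w_1}\cdots r_{w_m}$ and $R_w:l(V_m)\to l(V_0)$, $R_wv=v\circ F_w|_{V_0}$. A continuous function $h$ on $\mathcal{SG}_n$ is harmonic (with respect to $(D,\mathbf r)$) if $(H_m(h|_{V_m}))|_{V_m\setminus V_0}=0$ for all $m\geq 1$. Every function on $V_0$ extends uniquely to a harmonic function on $\mathcal{SG}_n$, and every $v\in l(V_1)$ with $(H_1v)|_{V_1\setminus V_0}=0$ extends uniquely to a harmonic function on $\mathcal{SG}_n$. Non-degeneracy. A harmonic structure is degenerate if there is a nonconstant harmonic function that is constant (equivalently, after subtracting a constant,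 vanishing) on some cell; otherwise it is non-degenerate. *)

(* Defs.v *)
From HB Require Import structures.
From mathcomp Require Import all_boot all_order all_algebra.
From mathcomp Require Import finmap.
From mathcomp Require Import all_classical all_reals all_analysis.

Set Implicit Arguments.
Unset Strict Implicit.
Unset Printing Implicit Defensive.

Import Order.TTheory GRing.Theory Num.Theory.
Import numFieldNormedType.Exports.

Local Open Scope classical_set_scope.
Local Open Scope ring_scope.

Section Laplacian.
Variables (R : realType) (V : finType).

(* A linear operator on l(V) = (V -> R) is given by its matrix H : V -> V -> R. *)
Definition lapply (H : V -> V -> R) (u : V -> R) : V -> R :=
  fun p => \sum_(q : V) H p q * u q.

Definition is_laplacian (H : V -> V -> R) : Prop :=
  [/\ forall p q, H p q = H q p,
      forall u : V -> R, \sum_(p : V) u p * lapply H u p <= 0,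
      forall u : V -> R,
        (forall p, lapply H u p = 0) <-> (exists c : R, forall p, u p = c)
    & forall p q, p != q -> 0 <= H p q].

End Laplacian.

Section Gasket.
Variable R : realType.
Local Notation plane := 'rV[R]_2.

(* The norm on 'rV[R]_2 in the library is the sup norm, so the Euclidean side
   length is written out. *)
Definition equilateral (q : 'I_3 -> plane) : Prop :=
  exists2 l : R, 0 < l &
    forall i j, i != j -> \sum_(k < 2) (q i 0 k - q j 0 k) ^+ 2 = l ^+ 2.

Definition gasket_map (n : nat) (q : 'I_3 -> plane) (a b c : nat)
    (z : plane) : plane :=
  n%:R^-1 *: z
  + n%:R^-1 *: (a%:R *: q 0 + b%:R *: q 1 + c%:R *: q ord_max).

Definition gasketN (n : nat) : nat := ((n ^ 2 + n - 2) %/ 2)%N.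

Definition enumerates_contractions (n : nat) (q : 'I_3 -> plane)
    (F : 'I_(gasketN n).+1 -> plane -> plane) : Prop :=
  injective F /\
  range F = [set f | exists a b c : nat,
                       (a + b + c = n - 1)%N /\ f = gasket_map n q a b c].

Definition V0 (q : 'I_3 -> plane) : {fset plane} := [fset q i | i : 'I_3]%fset.

Section IFS.
Variables (N : nat) (F : 'I_N.+1 -> plane -> plane) (q : 'I_3 -> plane).

(* By Hutchinson's theorem these conditions determine K uniquely. *)
Definition is_attractor (K : set plane) : Prop :=
  [/\ K !=set0, compact K & K = \bigcup_(i in [set: 'I_N.+1]) (F i @` K)].

Definition Fword (w : seq 'I_N.+1) : plane -> plane :=
  foldr (fun i f => F i \o f) id w.

Definition cell (K : set plane) (w : seq 'I_N.+1) : set plane :=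
  Fword w @` K.

Definition Vm (m : nat) : {fset plane} :=
  [fset Fword (w : m.-tuple 'I_N.+1) x | w : m.-tuple 'I_N.+1, x in V0 q]%fset.

Lemma Fword_in_Vm m (w : m.-tuple 'I_N.+1) (x : V0 q) :
  Fword w (val x) \in Vm m.
Proof. by apply/imfset2P; exists w => //; exists (val x) => //=; exact: valP. Qed.

Definition Rword m (w : m.-tuple 'I_N.+1) (v : Vm m -> R) : V0 q -> R :=
  fun x => v [` Fword_in_Vm w x]%fset.

(* The transpose of [Rword w]. *)
Definition Rword_tr m (w : m.-tuple 'I_N.+1) (f : V0 q -> R) : Vm m -> R :=
  fun p => \sum_(x : V0 q | Fword w (val x) == val p) f x.

Variables (D : V0 q -> V0 q -> R) (r : 'I_N.+1 -> R).

Definition E0 (u v : V0 q -> R) : R :=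
  \sum_(x : V0 q) \sum_(y : V0 q) D x y * (u x - u y) * (v x - v y).

Definition E1 (u v : Vm 1 -> R) : R :=
  \sum_(i < N.+1) (r i)^-1 * E0 (Rword [tuple i] u) (Rword [tuple i] v).

Definition extends (v : Vm 1 -> R) (u : V0 q -> R) : Prop :=
  forall (p : Vm 1) (x : V0 q), val p = val x -> v p = u x.

Definition harmonic_structure : Prop :=
  [/\ is_laplacian D,
      forall i, 0 < r i
    & forall u : V0 q -> R,
        (exists2 v, extends v u & E0 u u = E1 v v) /\
        (forall v, extends v u -> E0 u u <= E1 v v)].

Definition rword (w : seq 'I_N.+1) : R := \prod_(i <- w) r i.

Definition Hm (m : nat) (u : Vm m -> R) : Vm m -> R :=
  fun p => \sum_(w : m.-tuple 'I_N.+1)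
             (rword w)^-1 * Rword_tr w (lapply D (Rword w u)) p.

(* A function on K is represented by a function on the plane; only its values
   on K matter. *)
Definition harmonic_function (K : set plane) (h : plane -> R) : Prop :=
  {within K, continuous h} /\
  forall m, (1 <= m)%N -> forall p : Vm m,
    val p \notin V0 q -> Hm (fun p' : Vm m => h (val p')) p = 0.

Definition constant_on (A : set plane) (h : plane -> R) : Prop :=
  exists c : R, forall x, A x -> h x = c.

Definition degenerate_structure (K : set plane) : Prop :=
  exists (h : plane -> R) (w : seq 'I_N.+1),
    [/\ harmonic_function K h, ~ constant_on K h & constant_on (cell K w) h].

Definition nondegenerate_structure (K : set plane) : Prop := ~ degenerate_structure K.

End IFS.
End Gasket.

(* Main.v *)
(* By a trace argument all off-diagonal entries of [D] are positive: if [D a b = 0],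
   the energy minimizer with boundary value the indicator of [a] vanishes at [b] and
   has zero flux there, so its zero set spreads along the side from [b] to [a].

   Hence a harmonic function restricted to [F_w V_1] is a function [v] on a
   triangular lattice which, at every vertex but the three corners, is either equal
   to all neighbouring values or has a strictly larger and a strictly smaller
   neighbouring value.  Suppose [v] is constant on a small triangle.  Break the ties
   of [v] by a generic linear function.  Every triangle then has exactly one middle
   vertex, and a vertex is the middle vertex of as many triangles as there are sign
   changes of [v - v(x)] around it.  There are at least two sign changes at interior
   vertices and one at non-corner boundary vertices, and comparing with the number of
   triangles leaves room for only one more in total.  But if the triangle has a
   non-corner vertex with a different neighbouring value, some tie-breaking produces
   two superfluous sign changes there.  So flatness spreads over the whole lattice,
   i.e. from a cell [F_w_i V_0] to [F_w V_1]. *)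
Require Import Defs.
From mathcomp Require Import all_boot all_order all_algebra.
From mathcomp Require Import finmap.
From mathcomp Require Import all_classical all_reals all_analysis.
From mathcomp Require Import zify ring lra.

Set Implicit Arguments.
Unset Strict Implicit.
Unset Printing Implicit Defensive.

Import Order.TTheory GRing.Theory Num.Theory.
Import numFieldNormedType.Exports.

(** * Counting middle vertices *)

Lemma sum_shift n (G : nat -> nat) : G n = 0%N ->
  (\sum_(i < n.+1) (0 < i) * G i.-1 = \sum_(i < n.+1) G i)%N.
Proof.
move=> Gn; rewrite big_ord_recl /= mul0n add0n [RHS]big_ord_recr /= Gn addn0.
by apply: eq_bigr => i _; rewrite /bump /= mul1n.
Qed.

Lemma sum_shift_fst n (G : nat -> nat -> nat) : (forall j, G n j = 0%N) ->
  (\sum_(i < n.+1) \sum_(j < n.+1) (0 < i) * G i.-1 j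
   = \sum_(i < n.+1) \sum_(j < n.+1) G i j)%N.
Proof.
move=> Gn; rewrite exchange_big [RHS]exchange_big /=.
by apply: eq_bigr => j _; apply: (sum_shift (G := G ^~ j)).
Qed.

Lemma sum_shift_snd n (G : nat -> nat -> nat) : (forall i, G i n = 0%N) ->
  (\sum_(i < n.+1) \sum_(j < n.+1) (0 < j) * G i j.-1
   = \sum_(i < n.+1) \sum_(j < n.+1) G i j)%N.
Proof. by move=> Gn; apply: eq_bigr => i _; apply: sum_shift. Qed.

(* [A], [B], [C] say whether there is an upward triangle with its lower left,
   lower right, resp. top vertex at the given vertex; [s] are the signs of the six
   neighbours in cyclic order, and the sum counts the sign changes. *)
Definition sign_changes (A B C s0 s1 s2 s3 s4 s5 : bool) : nat :=
  ((A && (s0 (+) s1)) + (A && B && (s2 (+) s1)) + (B && (s2 (+) s3))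
   + (B && C && (s4 (+) s3)) + (C && (s4 (+) s5)) + (C && A && (s0 (+) s5)))%N.

Section MiddleCount.
Variables (disp : Order.disp_t) (T : orderType disp) (n : nat).
Variable key : nat -> nat -> T.

(* Number of lattice triangles of which [(i, j)] is the middle vertex. *)
Definition mid_count (i j : nat) : nat :=
  let lt x y := (key i j < key x y)%O in
  sign_changes (i + j < n)%N (0 < i)%N (0 < j)%N
    (lt i.+1 j) (lt i j.+1) (lt i.-1 j.+1) (lt i.-1 j) (lt i j.-1) (lt i.+1 j.-1).

(* Charges upward triangles to their lower left vertex and downward triangles to their
   upper right vertex; its excess over the required number of sign changes (two inside,
   one on a side, none at a corner) is a single unit, at the origin. *)
Definition base_count (i j : nat) : nat := ((i + j < n) + ((0 < i) && (0 < j)))%N.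

Hypothesis key_e0 : forall i j, key i.+1 j != key i j.
Hypothesis key_e1 : forall i j, key i j.+1 != key i j.
Hypothesis key_e01 : forall i j, key i.+1 j != key i j.+1.

(** For distinct values this is 1 exactly when [x] lies between [y] and [z]. *)
Let mid (x y z : T) : nat := (x < y)%O (+) (x < z)%O.

Let mid_sum (x y z : T) : x != y -> y != z -> z != x ->
  (mid x y z + mid y z x + mid z x y = 1)%N.
Proof.
rewrite /mid; case: (ltgtP x y) => //; case: (ltgtP y z) => //; case: (ltgtP z x) => //.
- by move=> zx yz xy; have := lt_trans zx (lt_trans xy yz); rewrite ltxx.
- by move=> zx yz xy; have := lt_trans zx (lt_trans yz xy); rewrite ltxx.
Qed.

(** Double counting: keys that differ along every edge give each triangle exactly one middle vertex,
    so both sides are the number of triangles. *)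
Lemma sum_mid_count :
  (\sum_(i < n.+1) \sum_(j < n.+1 ) (i + j <= n) * mid_count i j
   = \sum_(i < n.+1) \sum_(j < n.+1) (i + j <= n) * base_count i j)%N.
Proof.
(* [U] is for the upward triangle [a], [b], [c] at [(i, j)] and [W] for the downward one [b], [c],
   [d]; the first argument is the vertex tested for being the middle one. *)
pose U x y z i j := ((i + j < n) * mid (key (i + x.1) (j + x.2))
  (key (i + y.1) (j + y.2)) (key (i + z.1) (j + z.2)))%N.
pose W x y z i j := ((i + j + 1 < n) * mid (key (i + x.1) (j + x.2))
  (key (i + y.1) (j + y.2)) (key (i + z.1) (j + z.2)))%N.
pose a := (0, 0)%N; pose b := (1, 0)%N; pose c := (0, 1)%N; pose d := (1, 1)%N.
pose S (G : nat -> nat -> nat) := (\sum_(i < n.+1) \sum_(j < n.+1) G i j)%N.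
have SD G H : S (fun i j => G i j + H i j)%N = (S G + S H)%N.
  by rewrite /S -big_split /=; apply: eq_bigr => i _; rewrite -big_split.
have Sfst G : (forall j, G n j = 0%N) -> S (fun i j => (0 < i) * G i.-1 j)%N = S G.
  exact: sum_shift_fst.
have Ssnd G : (forall i, G i n = 0%N) -> S (fun i j => (0 < j) * G i j.-1)%N = S G.
  exact: sum_shift_snd.
have eqS G H : (forall i j, G i j = H i j) -> S G = S H.
  by move=> GH; apply: eq_bigr => i _; apply: eq_bigr => j _.
have Un x y z j : U x y z n j = 0%N by rewrite /U ltnNge leq_addr.
have nU x y z j : U x y z j n = 0%N by rewrite /U ltnNge leq_addl.
have Wn x y z j : W x y z n j = 0%N by rewrite /W ltnNge -addnA leq_addr.
have nW x y z j : W x y z j n = 0%N by rewrite /W ltnNge addnAC leq_addl.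
have eqT : S (U a b c) + S (W b c d) + S (U b c a) + S (W d b c) + S (U c a b)
    + S (W c d b) = S (fun i j => (i + j < n) + (i + j + 1 < n))%N.
  have perm3 u v w x y z : (u + v + w + x + y + z = (u + w + y) + (v + z + x))%N by lia.
  rewrite perm3 -!SD; apply: eqS => i j; rewrite /U /W -!mulnDr /=.
  have e0 : key i j != key i.+1 j by rewrite eq_sym.
  have e1 : key i.+1 j.+1 != key i.+1 j by [].
  have e2 : key i j.+1 != key i.+1 j.+1 by rewrite eq_sym.
  by rewrite !addn0 !addn1 mid_sum // mid_sum // !muln1.
have eqB : S (fun i j => (i + j <= n) * base_count i j)%N
    = S (fun i j => (i + j < n) + (i + j + 1 < n))%N.
  pose G i j : nat := (i + j + 1 < n).
  have Gn j : G n j = 0 by rewrite /G ltnNge -addnA leq_addr.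
  have nG i : (0 < i) * G i.-1 n = 0 by rewrite /G; case: i => // i; lia.
  rewrite (SD (fun i j => i + j < n : nat) G) -(Sfst G Gn) -(Ssnd _ nG) /G.
  rewrite -SD; apply: eqS => i j; rewrite /base_count.
  by case: i j => [|i] [|j] /=; lia.
rewrite -[LHS]/(S (fun i j => (i + j <= n) * mid_count i j)%N) [RHS]eqB -eqT.
(* The shifts move each term from the base point of its triangle to the tested vertex, so that the
   two sides agree vertex by vertex. *)
rewrite -(Sfst (W b c d)) // -(Sfst (U b c a)) // -(Sfst (W d b c)) //.
rewrite -(Ssnd (fun i j => (0 < i) * W d b c i.-1 j)%N); last by move=> i; rewrite nW muln0.
rewrite -(Ssnd (U c a b)) // -(Ssnd (W c d b)) // -!SD.
apply: eqS => i j; rewrite /mid_count /sign_changes /U /W /mid.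
have ltS k : (k.+1 < n) -> (k < n) by apply: ltnW.
case: i j => [|i] [|j] /=; rewrite ?addn0 ?addn1 ?addSn ?addnS ?ltnS ?leq0n /=;
  rewrite ?mul1n ?mul0n ?add0n ?addn0 ?andbT ?andbF ?addn0 ?mulnb ?leq0n ?andbT //.
- by case: (boolP (j.+1 < n)) => [/ltS -> | _] /=; case: (j < n); rewrite /= ?mul1n ?mul0n; ring.
- by case: (boolP (i.+1 < n)) => [/ltS -> | _] /=; case: (i < n); rewrite /= ?mul1n ?mul0n; ring.
- case: (boolP ((i + j).+2 < n)) => [/ltS -> | _] /=; first by ring.
  by case: (_ < n); rewrite /= ?mul1n ?mul0n; ring.
Qed.
End MiddleCount.

(** Since [f] has the smaller total, a surplus of [f] at one point must be paid for elsewhere, and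
    only the origin can pay, by one unit. *)
Lemma sum_ge_excess n (f g : nat -> nat -> nat) (i0 j0 : nat) :
  (i0 <= n) -> (j0 <= n) -> (0 < i0 + j0) ->
  (forall i j, g i j <= f i j + ((i == 0) && (j == 0))) ->
  (\sum_(i < n.+1) \sum_(j < n.+1) f i j
    <= \sum_(i < n.+1) \sum_(j < n.+1) g i j) ->
  f i0 j0 <= (g i0 j0).+1.
Proof.
move=> i0n j0n ij0 gf; rewrite !pair_bigA /=.
pose o : 'I_n.+1 * 'I_n.+1 := (ord0, ord0).
pose x : 'I_n.+1 * 'I_n.+1 := (Ordinal (i0n : i0 < n.+1), Ordinal (j0n : j0 < n.+1)).
have xo : x != o by rewrite /x /o xpair_eqE -!val_eqE /=; lia.
rewrite (bigD1 o) //= (bigD1 x) //= [X in _ <= X](bigD1 o) //=.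
rewrite [X in _ <= _ + X](bigD1 x) //=.
have := gf 0 0; rewrite eqxx /= => g0.
have rest : \sum_(p : 'I_n.+1 * 'I_n.+1 | (p != o) && (p != x)) g p.1 p.2
    <= \sum_(p : 'I_n.+1 * 'I_n.+1 | (p != o) && (p != x)) f p.1 p.2.
  apply: leq_sum => -[i j] /= /andP[ij _]; have := gf i j.
  by move: ij; rewrite /o xpair_eqE -!val_eqE /= => /negPf ->; rewrite addn0.
move: rest; move: (\sum_(p | _) g _ _) (\sum_(p | _) f _ _) => u w; lia.
Qed.

(** * Sign patterns around a vertex *)

Definition compare_to (d : Order.disp_t) (T : orderType d) (x y : T) : option bool :=
  if (x < y)%O then Some true else if (y < x)%O then Some false else None.

Section SignPatterns.
Variables A B C : bool.
Variables d0 d1 d2 d3 d4 d5 : option bool.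

Definition flat_signs : bool :=
  [&& A ==> (d0 == None) && (d1 == None), B ==> (d2 == None) && (d3 == None)
    & C ==> (d4 == None) && (d5 == None)].

Definition has_sign (b : bool) : bool :=
  [|| A && ((d0 == Some b) || (d1 == Some b)),
      B && ((d2 == Some b) || (d3 == Some b))
    | C && ((d4 == Some b) || (d5 == Some b))].

Definition balanced_signs : bool :=
  flat_signs || (has_sign true && has_sign false).

(* Ties are broken by a linear function, whose signs in opposite directions are
   opposite. *)
Definition resolved_changes (c0 c1 c2 : bool) : nat :=
  sign_changes A B C (odflt c0 d0) (odflt c1 d1) (odflt c2 d2)
    (odflt (~~ c0) d3) (odflt (~~ c1) d4) (odflt (~~ c2) d5).

Definition two_of_three : bool := [|| A && B, B && C | A && C].

Definition has_flat_triangle : bool :=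
  [|| [&& A, d0 == None & d1 == None], [&& B, d2 == None & d3 == None]
    | [&& C, d4 == None & d5 == None]].
End SignPatterns.

(* The sign patterns (of [al], [be] and [be - al]) of a generic linear function
   [al * i + be * j]. *)
Definition linear_pattern (c0 c1 c2 : bool) : bool := (c0 != c1) ==> (c2 == c1).

(** Quantifiers as boolean functions, so that the finite check is decided by computation. *)
Definition all_bool (P : pred bool) : bool := P true && P false.
Definition all_sign (P : pred (option bool)) : bool :=
  [&& P None, P (Some true) & P (Some false)].
Definition all_pattern (P : bool -> bool -> bool -> bool) : bool :=
  all_bool (fun c0 => all_bool (fun c1 => all_bool (fun c2 =>
    linear_pattern c0 c1 c2 ==> P c0 c1 c2))).

Lemma all_boolP (P : pred bool) : all_bool P -> forall b, P b.
Proof. by move=> /andP[? ?] []. Qed.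

Lemma all_signP (P : pred (option bool)) : all_sign P -> forall d, P d.
Proof. by move=> /and3P[? ? ?] [[]|]. Qed.

Lemma all_patternP (P : bool -> bool -> bool -> bool) :
  reflect (forall c0 c1 c2, linear_pattern c0 c1 c2 -> P c0 c1 c2) (all_pattern P).
Proof.
apply: (iffP idP) => [/all_boolP H c0 c1 c2 | H].
  by have /all_boolP/(_ c1)/all_boolP/(_ c2)/implyP := H c0.
by rewrite /all_pattern /all_bool /= !H.
Qed.

(** [A + (B && C)] is [base_count] at the vertex. Every tie-breaking reaches it, and if none exceeds
    it by more than one, a single flat triangle makes all neighbours tie. *)
Definition sign_check (A B C : bool) (d0 d1 d2 d3 d4 d5 : option bool) : bool :=
  (two_of_three A B C && balanced_signs A B C d0 d1 d2 d3 d4 d5) ==>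
  all_pattern (fun c0 c1 c2 =>
    A + (B && C) <= resolved_changes A B C d0 d1 d2 d3 d4 d5 c0 c1 c2) &&
  (all_pattern (fun c0 c1 c2 =>
     resolved_changes A B C d0 d1 d2 d3 d4 d5 c0 c1 c2 <= (A + (B && C)).+1) &&
   has_flat_triangle A B C d0 d1 d2 d3 d4 d5 ==> flat_signs A B C d0 d1 d2 d3 d4 d5).

(* A finite verification. For the flatness part: if a triangle at the vertex is flat
   and some neighbour is not, then there are neighbours of both signs, and the two
   ties in that triangle can be broken so as to create two superfluous sign changes. *)
Lemma sign_checkT A B C d0 d1 d2 d3 d4 d5 : sign_check A B C d0 d1 d2 d3 d4 d5.
Proof.
suff: all_bool (fun A => all_bool (fun B => all_bool (fun C =>
  all_sign (fun d0 => all_sign (fun d1 => all_sign (fun d2 => all_sign (fun d3 =>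
  all_sign (fun d4 => all_sign (fun d5 => sign_check A B C d0 d1 d2 d3 d4 d5
  ))))))))).
  move=> /all_boolP/(_ A)/all_boolP/(_ B)/all_boolP/(_ C)/all_signP/(_ d0).
  by move=> /all_signP/(_ d1)/all_signP/(_ d2)/all_signP/(_ d3)/all_signP/(_ d4)/all_signP.
by vm_compute.
Qed.

Local Open Scope ring_scope.

(** * Functions on the triangular lattice *)

Section LatticeFunction.
Variables (R : realDomainType) (n : nat).
Implicit Types (v : nat * nat -> R) (x y : nat * nat).

(** Every edge lies in exactly one upward triangle, so the neighbours come in pairs, one for each
    upward triangle at [x], in the cyclic order of [sign_changes]. *)
Definition lattice_nbrs x : seq (nat * nat) :=
  let: (i, j) := x in
  (if i + j < n then [:: (i.+1, j); (i, j.+1)] else [::])%N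
  ++ (if 0 < i then [:: (i.-1, j.+1); (i.-1, j)] else [::])%N
  ++ (if 0 < j then [:: (i, j.-1); (i.+1, j.-1)] else [::])%N.

Definition noncorner x : bool :=
  [&& x.1 + x.2 <= n, x.1 < n, x.2 < n & 0 < x.1 + x.2]%N.

(* What survives of harmonicity at [x] when the conductances are arbitrary. *)
Definition balanced v x : bool :=
  all (fun y => v y == v x) (lattice_nbrs x)
  || has (fun y => v x < v y) (lattice_nbrs x) && has (fun y => v y < v x) (lattice_nbrs x).

Local Notation at_vertex F v i j := (F (i + j < n)%N (0 < i)%N (0 < j)%N
  (compare_to (v (i, j)) (v (i.+1, j))) (compare_to (v (i, j)) (v (i, j.+1)))
  (compare_to (v (i, j)) (v (i.-1, j.+1))) (compare_to (v (i, j)) (v (i.-1, j)))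
  (compare_to (v (i, j)) (v (i, j.-1))) (compare_to (v (i, j)) (v (i.+1, j.-1)))).

Lemma compare_to_None (a b : R) : (compare_to a b == None) = (b == a).
Proof. by rewrite /compare_to; case: ltgtP. Qed.

Lemma compare_to_true (a b : R) : (compare_to a b == Some true) = (a < b).
Proof. by rewrite /compare_to; case: ltgtP. Qed.

Lemma compare_to_false (a b : R) : (compare_to a b == Some false) = (b < a).
Proof. by rewrite /compare_to; case: ltgtP. Qed.

Lemma flat_signsE v i j :
  at_vertex flat_signs v i j = all (fun y => v y == v (i, j)) (lattice_nbrs (i, j)).
Proof.
rewrite /flat_signs !compare_to_None !all_cat.
by case: (i + j < n)%N; case: (0 < i)%N; case: (0 < j)%N; rewrite /= ?andbT.
Qed.

Lemma balanced_signsE v i j : at_vertex balanced_signs v i j = balanced v (i, j).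
Proof.
rewrite /balanced_signs /balanced flat_signsE /has_sign !has_cat.
rewrite !compare_to_true !compare_to_false.
by case: (i + j < n)%N; case: (0 < i)%N; case: (0 < j)%N; rewrite /= ?orbF.
Qed.

Lemma two_of_three_noncorner i j : noncorner (i, j) ->
  two_of_three (i + j < n)%N (0 < i)%N (0 < j)%N.
Proof. by rewrite /noncorner /two_of_three /=; lia. Qed.

Definition tie_key v (al be : int) i j : R *l int := (v (i, j), al * i%:Z + be * j%:Z).

Lemma tie_key_lt v al be i j i' j' :
  (tie_key v al be i j < tie_key v al be i' j')%O
  = odflt (al * i%:Z + be * j%:Z < al * i'%:Z + be * j'%:Z)
      (compare_to (v (i, j)) (v (i', j'))).
Proof. by rewrite /tie_key ltEprodlexi /compare_to /=; case: (ltgtP (v (i, j))). Qed.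

Section TieBreaking.
Variables (v : nat * nat -> R) (al be : int).
Hypotheses (al0 : al != 0) (be0 : be != 0) (albe : al != be).

Lemma mid_count_tie_key i j : mid_count n (tie_key v al be) i j
  = at_vertex resolved_changes v i j (0 < al) (0 < be) (al < be).
Proof.
have g0 (k l : nat) : (al * k%:Z + be * l%:Z < al * k.+1%:Z + be * l%:Z) = (0 < al) by lia.
have g1 (k l : nat) : (al * k%:Z + be * l%:Z < al * k%:Z + be * l.+1%:Z) = (0 < be) by lia.
have g2 (k l : nat) : (al * k.+1%:Z + be * l%:Z < al * k%:Z + be * l.+1%:Z) = (al < be).
  by lia.
have g3 (k l : nat) : (al * k.+1%:Z + be * l%:Z < al * k%:Z + be * l%:Z) = ~~ (0 < al).
  by lia.
have g4 (k l : nat) : (al * k%:Z + be * l.+1%:Z < al * k%:Z + be * l%:Z) = ~~ (0 < be).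
  by lia.
have g5 (k l : nat) : (al * k%:Z + be * l.+1%:Z < al * k.+1%:Z + be * l%:Z) = ~~ (al < be).
  by lia.
rewrite /mid_count /resolved_changes !tie_key_lt.
by case: i j => [|i] [|j] /=; rewrite /sign_changes /= ?andbF /= ?(g0, g1, g2, g3, g4, g5).
Qed.

Hypothesis bal : forall x, noncorner x -> balanced v x.

Lemma base_count_le i j : noncorner (i, j) ->
  (base_count n i j <= mid_count n (tie_key v al be) i j)%N.
Proof.
move=> ij; rewrite mid_count_tie_key.
have lp : linear_pattern (0 < al) (0 < be) (al < be) by rewrite /linear_pattern; lia.
have := at_vertex sign_checkT v i j; rewrite /sign_check balanced_signsE.
by rewrite two_of_three_noncorner // bal //= => /andP[/all_patternP/(_ _ _ _ lp)].
Qed.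

(** The totals of [mid_count] and [base_count] agree, and [base_count_le] is a lower bound at every
    noncorner vertex. Among the corners only the origin can have a positive [base_count], at most 1,
    so there is at most one unit of surplus. *)
Lemma mid_count_le i j : noncorner (i, j) ->
  (mid_count n (tie_key v al be) i j <= (base_count n i j).+1)%N.
Proof.
move=> ij.
have key0 k l : tie_key v al be k.+1 l != tie_key v al be k l.
  by rewrite /tie_key xpair_eqE negb_and; apply/orP; right; lia.
have key1 k l : tie_key v al be k l.+1 != tie_key v al be k l.
  by rewrite /tie_key xpair_eqE negb_and; apply/orP; right; lia.
have key01 k l : tie_key v al be k.+1 l != tie_key v al be k l.+1.
  by rewrite /tie_key xpair_eqE negb_and; apply/orP; right; lia.
pose f k l := ((k + l <= n) * mid_count n (tie_key v al be) k l)%N.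
pose g k l := ((k + l <= n) * base_count n k l)%N.
have gf k l : (g k l <= f k l + ((k == 0) && (l == 0)))%N.
  rewrite /f /g; case: (boolP (noncorner (k, l))) => [kl|].
    by apply: leq_trans (leq_addr _ _); rewrite leq_mul // base_count_le.
  rewrite /noncorner /= /base_count; case: (leqP (k + l) n) => //= kln.
  by case: k l kln => [|k] [|l] /=; lia.
have [ijn [i_n [j_n ij0]]] : (i + j <= n)%N /\ (i <= n)%N /\ (j <= n)%N /\ (0 < i + j)%N.
  by move: ij; rewrite /noncorner /=; lia.
have := sum_ge_excess i_n j_n ij0 gf (eq_leq (sum_mid_count n key0 key1 key01)).
by rewrite /f /g ijn !mul1n.
Qed.
End TieBreaking.

Lemma has_flat_triangle_flat v i j : (forall x, noncorner x -> balanced v x) ->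
  noncorner (i, j) -> at_vertex has_flat_triangle v i j ->
  {in lattice_nbrs (i, j), forall y, v y = v (i, j)}.
Proof.
move=> bal ij flat y yx; apply/eqP; move: y yx; apply/allP; rewrite -flat_signsE.
(* Small integer slopes realise each of the six sign patterns of a generic linear function. *)
have slopes c0 c1 c2 : linear_pattern c0 c1 c2 -> exists al be : int,
    [/\ [/\ al != 0, be != 0 & al != be], (0 < al) = c0, (0 < be) = c1 & (al < be) = c2].
  by case: c0 c1 c2 => [] [] [] //= _;
    [exists 1, 2 | exists 2, 1 | exists 1, (-1) | exists (-1), 1 | exists (-2), (-1)
    | exists (-1), (-2)].
have := at_vertex sign_checkT v i j; rewrite /sign_check balanced_signsE.
rewrite two_of_three_noncorner // bal //= flat andbT => /andP[_] /implyP; apply.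
apply/all_patternP => c0 c1 c2 /slopes[al [be [[al0 be0 albe] <- <- <-]]].
by rewrite -mid_count_tie_key // mid_count_le.
Qed.

Definition lattice_triangle (i j : nat) : seq (nat * nat) :=
  [:: (i, j); (i.+1, j); (i, j.+1)].

(** * Flatness spreads from one triangle to the whole lattice *)

Section Rigidity.
Variable v : nat * nat -> R.
Hypothesis bal : forall x, noncorner x -> balanced v x.
Variable c : R.

Let flat i j := {in lattice_triangle i j, forall y, v y = c}.

(** The flat triangle forces the value [c] on all neighbours of the shared noncorner vertex, and the
    other triangle consists of that vertex and two of its neighbours. *)
Lemma flat_triangle_adjacent x i j k l : (i + j < n)%N -> (k + l < n)%N ->
  noncorner x -> x \in lattice_triangle i j -> x \in lattice_triangle k l ->
  flat i j -> flat k l.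
Proof.
move=> ijn kln nx xij xkl fl.
have vx : v x = c by apply: fl.
suff H : {in lattice_nbrs x, forall y, v y = v x}.
  move=> y ykl; have [-> // | yx] := eqVneq y x; rewrite H //.
  move: ykl xkl yx; rewrite !inE => /or3P[] /eqP -> /or3P[] /eqP ->;
    rewrite ?eqxx //= => _; rewrite ?kln ?inE ?mem_cat ?inE ?eqxx ?orbT //.
case: x nx xij xkl vx => a b nx xij xkl vx; apply: has_flat_triangle_flat => //.
rewrite /has_flat_triangle !compare_to_None vx.
have f0 : v (i, j) = c by apply: fl; rewrite inE eqxx.
have f1 : v (i.+1, j) = c by apply: fl; rewrite !inE eqxx orbT.
have f2 : v (i, j.+1) = c by apply: fl; rewrite !inE eqxx !orbT.
by move: xij; rewrite !inE => /or3P[] /eqP[-> ->]; rewrite ?ijn /= ?f0 ?f1 ?f2 !eqxx ?orbT.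
Qed.

Lemma flat_triangle_all i j k l : (i + j < n)%N -> (k + l < n)%N -> flat i j -> flat k l.
Proof.
(* Adjacent upward triangles share a vertex that is not a corner; moves to the right and up link
   every triangle to the one at the origin. *)
have right a b : (a.+1 + b < n)%N -> flat a b <-> flat a.+1 b.
  move=> abn; have abn' : (a + b < n)%N by apply: ltnW.
  have nx : noncorner (a.+1, b) by rewrite /noncorner /=; lia.
  by split; apply: (@flat_triangle_adjacent (a.+1, b)) => //; rewrite !inE eqxx ?orbT.
have up a b : (a + b.+1 < n)%N -> flat a b <-> flat a b.+1.
  move=> abn; have abn' : (a + b < n)%N by lia.
  have nx : noncorner (a, b.+1) by rewrite /noncorner /=; lia.
  by split; apply: (@flat_triangle_adjacent (a, b.+1)) => //; rewrite !inE eqxx ?orbT.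
have origin a b : (a + b < n)%N -> flat a b <-> flat 0%N 0%N.
  elim: a => [|a IH] abn; last by rewrite -right // IH // ltnW.
  by elim: b abn => [|b IH] abn //; rewrite -up // IH // ltnW.
by move=> ijn kln /(origin _ _ ijn)/(origin _ _ kln).
Qed.

Theorem flat_triangle_constant i j k l : (i + j < n)%N -> flat i j ->
  (k + l <= n)%N -> v (k, l) = c.
Proof.
move=> ijn fl; case: k => [|k] kln.
  case: l kln => [|l] kln.
    by apply: (flat_triangle_all ijn _ fl (k := 0%N) (l := 0%N)); rewrite ?inE ?eqxx //; lia.
  by apply: (flat_triangle_all ijn _ fl (k := 0%N) (l := l)); rewrite ?inE ?eqxx ?orbT //; lia.
by apply: (flat_triangle_all ijn _ fl (k := k) (l := l)); rewrite ?inE ?eqxx ?orbT //; lia.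
Qed.
End Rigidity.

(** Maximum principle: a balanced vertex attaining the maximum is flat, so a neighbour with smaller
    [i + j] attains it too; the descent ends at a corner. *)
Lemma balanced_max v c : (forall x, noncorner x -> balanced v x) ->
  v (0, 0)%N <= c -> v (n, 0)%N <= c -> v (0, n)%N <= c ->
  forall i j, (i + j <= n)%N -> v (i, j) <= c.
Proof.
move=> bal v00 vn0 v0n.
pose P (p : 'I_n.+1 * 'I_n.+1) := (p.1 + p.2 <= n)%N.
case: (@arg_maxP _ _ _ (ord0, ord0) P (fun p => v (val p.1, val p.2))) => //= -[a b] Pab maxab.
have max k l : (k + l <= n)%N -> v (k, l) <= v (val a, val b).
  move=> kl; have kn : (k < n.+1)%N by lia. have ln : (l < n.+1)%N by lia.
  exact: (maxab (Ordinal kn, Ordinal ln)).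
suff M m k l : (k + l)%N = m -> (m <= n)%N -> v (k, l) = v (val a, val b) -> v (val a, val b) <= c.
  by move=> i j ij; apply: le_trans (max _ _ ij) _; apply: (M _ a b).
elim: m k l => [|m IH] k l klm mn vkl.
  have [k0 l0] : (k = 0 /\ l = 0)%N by lia.
  by rewrite -vkl k0 l0.
have [/bal | ] := boolP (noncorner (k, l)).
  case/orP=> [/allP flat | /andP[/hasP[y ykl vy] _]].
    case: k klm vkl flat => [|k] klm vkl flat.
      case: l klm vkl flat => [|l] klm vkl flat; first lia.
      apply: (IH 0%N l); [lia | lia |]; rewrite -vkl; apply/eqP/flat.
      by rewrite !mem_cat !inE eqxx ?orbT.
    apply: (IH k l); [lia | lia |]; rewrite -vkl; apply/eqP/flat.
    by rewrite !mem_cat !inE eqxx ?orbT.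
  suff : v y <= v (k, l) by rewrite leNgt vy.
  rewrite vkl; case: y ykl {vy} => y1 y2 ykl; apply: max.
  have {}mn : (k + l <= n)%N by rewrite klm.
  move: ykl; rewrite /= !mem_cat => /or3P[]; case: ifP => // ?;
    rewrite !inE => /orP[] /eqP[-> ->]; lia.
rewrite -vkl /noncorner => nc.
have [[-> ->] | [-> ->]] // : (k = n /\ l = 0 \/ k = 0 /\ l = n)%N.
by move: nc; rewrite /=; lia.
Qed.

Lemma balancedN v x : balanced (fun y => - v y) x = balanced v x.
Proof.
rewrite /balanced andbC; congr (_ || _ && _).
- by apply: eq_all => y; rewrite eqr_opp.
- by apply: eq_has => y; rewrite ltrN2.
- by apply: eq_has => y; rewrite ltrN2.
Qed.

Theorem balanced_constant v c : (forall x, noncorner x -> balanced v x) ->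
  v (0, 0)%N = c -> v (n, 0)%N = c -> v (0, n)%N = c ->
  forall i j, (i + j <= n)%N -> v (i, j) = c.
Proof.
move=> bal v00 vn0 v0n i j ij; apply/eqP; rewrite eq_le; apply/andP; split.
  by apply: balanced_max => //; rewrite ?v00 ?vn0 ?v0n.
rewrite -lerN2; apply: (balanced_max (v := fun y => - v y)) => //.
- by move=> x /bal; rewrite balancedN.
- by rewrite v00.
- by rewrite vn0.
- by rewrite v0n.
Qed.
End LatticeFunction.

Local Open Scope classical_set_scope.

(** * Barycentric coordinates and cells *)

Lemma sum3 (V : nmodType) (f : 'I_3 -> V) :
  \sum_(k < 3) f k = f 0 + f 1 + f ord_max.
Proof.
rewrite !big_ord_recl big_ord0 addr0 addrA; congr (_ + f _ + f _); exact: val_inj.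
Qed.

Lemma forall_ord3 (P : 'I_3 -> Prop) : P 0 -> P 1 -> P ord_max -> forall k, P k.
Proof.
move=> P0 P1 P2 [[|[|[|//]]] Hk].
- by have -> : Ordinal Hk = 0 by exact: val_inj.
- by have -> : Ordinal Hk = 1 by exact: val_inj.
- by have -> : Ordinal Hk = ord_max by exact: val_inj.
Qed.

Section Barycentric.
Variables (R : realType) (q : 'I_3 -> 'rV[R]_2).
Local Notation plane := 'rV[R]_2.

Definition bary (x : 'I_3 -> R) : plane := \sum_(k < 3) x k *: q k.

Definition simplex (x : 'I_3 -> R) : Prop :=
  (forall k, 0 <= x k) /\ \sum_(k < 3) x k = 1.

Definition triangle : set plane := [set p | exists2 x, simplex x & p = bary x].

Lemma baryD x y : bary x + bary y = bary (fun k => x k + y k).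
Proof. by rewrite /bary -big_split; apply: eq_bigr => k _; rewrite scalerDl. Qed.

Lemma baryZ a x : a *: bary x = bary (fun k => a * x k).
Proof. by rewrite /bary scaler_sumr; apply: eq_bigr => k _; rewrite scalerA. Qed.

Definition vertex (k : 'I_3) : 'I_3 -> R := fun l => (l == k)%:R.

Lemma bary_vertex k : bary (vertex k) = q k.
Proof.
rewrite /bary (bigD1 k) //= /vertex eqxx scale1r big1 ?addr0 // => l /negPf ->.
by rewrite scale0r.
Qed.

Lemma simplex_vertex k : simplex (vertex k).
Proof.
split=> [l|]; first by rewrite ler0n.
by rewrite (bigD1 k) //= /vertex eqxx big1 ?addr0 // => l /negPf ->.
Qed.

Lemma triangle_vertex k : triangle (q k).
Proof. by exists (vertex k); [exact: simplex_vertex | rewrite bary_vertex]. Qed.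

Lemma simplex_ge1 x k : simplex x -> 1 <= x k -> x =1 vertex k.
Proof.
move=> [x0]; rewrite (bigD1 k) //=.
set s := \sum_(l < 3 | _) _ => x1 xk.
have s0 : 0 <= s by apply: sumr_ge0.
have rest : s = 0 by lra.
move=> l; rewrite /vertex; have [->|lk] := eqVneq l k; first by rewrite /=; lra.
move/eqP: rest; rewrite psumr_eq0 // => /allP/(_ l).
by rewrite mem_index_enum lk => /(_ isT)/eqP.
Qed.

Hypothesis hq : equilateral q.

(* If the coefficients [z] sum to [0], then [|bary z|^2 = l^2 / 2 * \sum_k z k ^ 2]
   for the side length [l]. *)
Lemma bary_inj x y : \sum_(k < 3) x k = \sum_(k < 3) y k -> bary x = bary y -> x =1 y.
Proof.
case: hq => l l0 side; rewrite !sum3 => sxy bxy.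
have c0 : bary x 0 0 = bary y 0 0 by rewrite bxy.
have c1 : bary x 0 1 = bary y 0 1 by rewrite bxy.
have d (i j : 'I_3) : i != j -> (q i 0 0 - q j 0 0) ^+ 2 + (q i 0 1 - q j 0 1) ^+ 2 = l ^+ 2.
  move=> /side <-; rewrite big_ord_recl big_ord1; congr (_ + (q i _ _ - q j _ _) ^+ 2);
  exact: val_inj.
have := d 0 1 isT; have := d 0 ord_max isT; have := d 1 ord_max isT.
move: c0 c1; rewrite /bary !sum3 !mxE.
set a0 := q 0 0 0; set a1 := q 0 0 1; set b0 := q 1 0 0; set b1 := q 1 0 1.
set e0 := q ord_max 0 0; set e1 := q ord_max 0 1.
move: a0 a1 b0 b1 e0 e1 sxy => a0 a1 b0 b1 e0 e1.
set x0 := x 0; set x1 := x 1; set x2 := x ord_max.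
set y0 := y 0; set y1 := y 1; set y2 := y ord_max => sxy c0 c1 d12 d02 d01.
have z2 : x2 - y2 = - ((x0 - y0) + (x1 - y1)) by lra.
set u := x0 - y0 in z2; set w := x1 - y1 in z2.
have E0 : u * (a0 - e0) + w * (b0 - e0) = 0.
  have -> : u * (a0 - e0) + w * (b0 - e0) = u * a0 + w * b0 + (x2 - y2) * e0 by rewrite z2; ring.
  by rewrite /u /w; lra.
have E1 : u * (a1 - e1) + w * (b1 - e1) = 0.
  have -> : u * (a1 - e1) + w * (b1 - e1) = u * a1 + w * b1 + (x2 - y2) * e1 by rewrite z2; ring.
  by rewrite /u /w; lra.
have Z : l ^+ 2 * (u ^+ 2 + u * w + w ^+ 2) = 0.
  have -> : l ^+ 2 * (u ^+ 2 + u * w + w ^+ 2)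
    = (u * (a0 - e0) + w * (b0 - e0)) ^+ 2 + (u * (a1 - e1) + w * (b1 - e1)) ^+ 2.
    have : u ^+ 2 * (l ^+ 2) = u ^+ 2 * ((a0 - e0) ^+ 2 + (a1 - e1) ^+ 2) by rewrite d02.
    have : w ^+ 2 * (l ^+ 2) = w ^+ 2 * ((b0 - e0) ^+ 2 + (b1 - e1) ^+ 2) by rewrite d12.
    have : u * w * (l ^+ 2) = u * w * ((b0 - e0) ^+ 2 + (b1 - e1) ^+ 2
      + (a0 - e0) ^+ 2 + (a1 - e1) ^+ 2 - ((a0 - b0) ^+ 2 + (a1 - b1) ^+ 2)) by rewrite d01; congr (_ * _); lra.
    by lra.
  by rewrite E0 E1 expr0n addr0.
have Q : u ^+ 2 + u * w + w ^+ 2 = 0.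
  by apply/eqP; move/eqP: Z; rewrite mulf_eq0 expf_eq0 /= gt_eqF.
have w0 : w = 0.
  apply/eqP; rewrite -sqrf_eq0 eq_le sqr_ge0 andbT.
  (* [4 * (u ^+ 2 + u * w + w ^+ 2) = (2 * u + w) ^+ 2 + 3 * w ^+ 2]. *)
  by have := sqr_ge0 (2 * u + w); rewrite sqrrD; move: Q; rewrite exprMn; lra.
have u0 : u = 0.
  by apply/eqP; rewrite -sqrf_eq0; apply/eqP; move: Q; rewrite w0 mulr0 expr0n /= !addr0.
by apply: forall_ord3; move: u0 w0 z2; rewrite /u /w /x0 /x1 /x2 /y0 /y1 /y2; lra.
Qed.

Lemma vertex_inj : injective q.
Proof.
move=> k l; rewrite -!bary_vertex => /(bary_inj _)/(_ k).
rewrite /vertex eqxx; case: eqVneq => // _ H.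
have /H /eqP : \sum_m vertex k m = \sum_m vertex l m.
  by have [_ ->] := simplex_vertex k; have [_ ->] := simplex_vertex l.
by rewrite oner_eq0.
Qed.
End Barycentric.

Section Cells.
Variables (R : realType) (n : nat) (q : 'I_3 -> 'rV[R]_2).
Variable F : 'I_(gasketN n).+1 -> 'rV[R]_2 -> 'rV[R]_2.
Hypotheses (hn : (2 <= n)%N) (hq : equilateral q) (hF : enumerates_contractions q F).
Implicit Types (a b : 'I_3 -> nat) (y z : 'rV[R]_2).

Definition has_offset i a : Prop :=
  (\sum_(k < 3) a k = n.-1)%N /\
  forall y, F i y = n%:R^-1 *: (y + bary q (fun k => (a k)%:R)).

Let gasket_mapE a y : gasket_map n q (a 0) (a 1) (a ord_max) y
  = n%:R^-1 *: (y + bary q (fun k => (a k)%:R)).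
Proof. by rewrite /gasket_map /bary sum3 [RHS]scalerDr. Qed.

Lemma offset_exists i : exists a, has_offset i a.
Proof.
have [_ /seteqP[sF _]] := hF.
have [a [b [c [abc Fi]]]] := sF (F i) (ex_intro2 _ _ i I erefl).
pose al := fun k : 'I_3 => nth 0%N [:: a; b; c] k.
exists al; split; first by rewrite sum3 -subn1 -abc.
by move=> y; rewrite Fi -gasket_mapE.
Qed.

Lemma offset_cell a : (\sum_(k < 3) a k = n.-1)%N -> exists i, has_offset i a.
Proof.
move=> sa; have [_ /seteqP[_ Fs]] := hF.
have [|i _ Fi] := Fs (gasket_map n q (a 0) (a 1) (a ord_max)).
  by exists (a 0), (a 1), (a ord_max); rewrite subn1 -sa sum3.
by exists i; split=> // y; rewrite Fi gasket_mapE.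
Qed.

Lemma offset_unique i j a b : has_offset i a -> has_offset j b -> a =1 b -> i = j.
Proof.
move=> [_ Fi] [_ Fj] ab; have [Finj _] := hF; apply: Finj; apply/funext => y.
by rewrite Fi Fj; congr (_ *: (_ + _)); apply: eq_bigr => k _; rewrite ab.
Qed.

Lemma n_neq0 : n%:R != 0 :> R. Proof. by rewrite pnatr_eq0; lia. Qed.

Lemma cell_bary i a x : has_offset i a ->
  F i (bary q x) = bary q (fun k => n%:R^-1 * (x k + (a k)%:R)).
Proof. by case=> _ ->; rewrite baryD baryZ. Qed.

Lemma cell_inj i : injective (F i).
Proof.
have [a [_ Fi]] := offset_exists i; move=> y z; rewrite !Fi => /scalerI H.
by apply: (addIr (bary q (fun k => (a k)%:R))); apply: H; rewrite invr_eq0 n_neq0.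
Qed.

Lemma sum_cell a x : (\sum_(k < 3) a k = n.-1)%N -> simplex x ->
  \sum_(k < 3) n%:R^-1 * (x k + (a k)%:R) = 1 :> R.
Proof.
move=> sa [_ sx]; rewrite -mulr_sumr big_split /= sx -natr_sum sa.
by rewrite nat1r prednK ?mulVf ?n_neq0 //; lia.
Qed.

Lemma cell_triangle i y : triangle q y -> triangle q (F i y).
Proof.
case=> x sx ->; have [a ai] := offset_exists i; rewrite (cell_bary _ ai).
eexists; last by []; split; last by rewrite sum_cell //; case: ai.
by move=> k; rewrite mulr_ge0 ?invr_ge0 // addr_ge0 //; case: sx.
Qed.

(** A coordinate [l != k] of the image is [(x l + a l) / n] with nonnegative summands, so its
    vanishing forces [x l = 0]. *)
Lemma cell_vertex i y k : triangle q y -> F i y = q k -> y = q k.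
Proof.
case=> x sx ->; have [a ai] := offset_exists i; rewrite (cell_bary _ ai) -[RHS]bary_vertex.
have [sa _] := ai.
move=> /(bary_inj hq) H.
have {}H l : n%:R^-1 * (x l + (a l)%:R) = vertex R k l.
  by apply: H; rewrite sum_cell //; case: (simplex_vertex R k).
have x0 l : l != k -> x l = 0.
  move=> /negPf lk; have := H l; rewrite /vertex lk => /eqP.
  rewrite mulf_eq0 invr_eq0 (negPf n_neq0) /= addr_eq0 => /eqP xl.
  by apply/eqP; rewrite eq_le (proj1 sx) xl oppr_le0 ler0n.
have xk : 1 <= x k.
  by case: sx => _ <-; rewrite (bigD1 k) //= big1 ?addr0.
by rewrite -[RHS]bary_vertex; apply: eq_bigr => l _; rewrite (simplex_ge1 sx xk).
Qed.

(** Equal images give [x k + a k = w k + b k]. Distinct offsets have equal sums, so [a k < b k] for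
    some [k]; then [x k >= 1] puts [y] at [q k], and symmetrically for [z]. *)
Lemma cell_meet i j y z : triangle q y -> triangle q z -> F i y = F j z ->
  i = j \/ (exists k, y = q k) /\ (exists k, z = q k).
Proof.
case=> x sx ->; case=> w sw ->.
have [a ai] := offset_exists i; have [b bj] := offset_exists j.
rewrite (cell_bary _ ai) (cell_bary _ bj) => /(bary_inj hq) H.
have {}H k : x k + (a k)%:R = w k + (b k)%:R.
  have n0 : n%:R^-1 != 0 :> R by rewrite invr_eq0 n_neq0.
  by apply: (mulfI n0); apply: H; rewrite !sum_cell //; [case: bj | case: ai].
have lt_vertex (c d : 'I_3 -> nat) (u v : 'I_3 -> R) k : simplex u -> simplex v ->
    u k + (c k)%:R = v k + (d k)%:R -> (c k < d k)%N -> bary q u = q k.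
  move=> su [v0 _] e cd; rewrite -bary_vertex; apply: eq_bigr => l _.
  rewrite (simplex_ge1 su (k := k)) //.
  have := v0 k; have : (c k)%:R + 1 <= (d k)%:R :> R by rewrite natr1 ler_nat.
  lra.
have [ab | nab] := pselect (a =1 b); first by left; apply: offset_unique ab.
have exists_lt (c d : 'I_3 -> nat) : (\sum_(k < 3) c k = \sum_(k < 3) d k)%N ->
    ~ (c =1 d) -> exists k, (c k < d k)%N.
  rewrite !sum3 => cd ncd; apply/not_existsP => dc; apply: ncd.
  have {}dc k : (d k <= c k)%N by rewrite leqNgt; apply/negP/dc.
  move: (dc 0) (dc 1) (dc ord_max) cd => d0 d1 d2 cd.
  by apply: (forall_ord3 (P := fun k => c k = d k)); lia.
right; have [sa _] := ai; have [sb _] := bj; split.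
  have [|k abk] := exists_lt a b _ nab; first by rewrite sa sb.
  by exists k; apply: (lt_vertex a b x w k).
have [||k bak] := exists_lt b a; [by rewrite sa sb | by move=> ba; apply: nab => k; rewrite ba |].
by exists k; apply: (lt_vertex b a w x k).
Qed.
End Cells.

(** Serves twice: for the harmonic equation at a vertex and for the terms of an energy pairing. *)
Lemma weighted_sum_eq0 (R : realType) (I : finType) (P : pred I) (c d : I -> R) :
  (forall i, P i -> 0 <= c i) -> \sum_(i | P i) c i * d i = 0 ->
  (forall i, P i -> 0 < c i -> d i = 0) \/
  ((exists i, [/\ P i, 0 < c i & 0 < d i]) /\ (exists i, [/\ P i, 0 < c i & d i < 0])).
Proof.
have half (e : I -> R) : (forall i, P i -> 0 <= c i) -> \sum_(i | P i) c i * e i = 0 ->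
    ~ (exists i, [/\ P i, 0 < c i & e i < 0]) -> forall i, P i -> 0 < c i -> e i = 0.
  move=> c0 s0 nex i Pi ci; have := s0 => /eqP; rewrite psumr_eq0 => [/allP/(_ i)|j Pj].
    by rewrite mem_index_enum Pi mulf_eq0 gt_eqF //= => /(_ isT)/eqP.
  have := c0 j Pj; rewrite le_eqVlt => /predU1P[<-|cj]; first by rewrite mul0r.
  by rewrite mulr_ge0 ?c0 // leNgt; apply/negP => ej; apply: nex; exists j.
move=> c0 s0.
have [pos | npos] := pselect (exists i, [/\ P i, 0 < c i & 0 < d i]); last first.
  left=> i Pi ci; apply: oppr_inj; rewrite oppr0.
  apply: (half (fun i => - d i)) ci => //.
    by rewrite (eq_bigr _ (fun i _ => mulrN _ _)) sumrN s0 oppr0.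
  by case=> j [Pj cj dj]; apply: npos; exists j; split=> //; rewrite -oppr_lt0.
have [neg | nneg] := pselect (exists i, [/\ P i, 0 < c i & d i < 0]); first by right.
by left; apply: half.
Qed.

(** * Addresses of points *)

Section Words.
Variables (R : realType) (n : nat) (q : 'I_3 -> 'rV[R]_2).
Variable F : 'I_(gasketN n).+1 -> 'rV[R]_2 -> 'rV[R]_2.
Hypotheses (hn : (2 <= n)%N) (hq : equilateral q) (hF : enumerates_contractions q F).
Implicit Types (w : seq 'I_(gasketN n).+1) (y z p : 'rV[R]_2).

Lemma V0P y : reflect (exists k, y = q k) (y \in V0 q).
Proof.
apply: (iffP (imfsetP _ _ _ _)) => [[k _ ->] | [k ->]]; first by exists k.
by exists k.
Qed.

Lemma Fword_rcons w i y : Fword F (rcons w i) y = Fword F w (F i y).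
Proof. by elim: w => //= j w ->. Qed.

Lemma Fword_triangle w y : triangle q y -> triangle q (Fword F w y).
Proof. by move=> Ty; elim: w => //= i w; apply: cell_triangle. Qed.

Lemma Fword_V0 w y : triangle q y -> Fword F w y \in V0 q -> y \in V0 q.
Proof.
move=> Ty; elim: w => //= i w IH /V0P[k Fk]; apply: IH.
by rewrite (cell_vertex hn hq hF (Fword_triangle w Ty) Fk); apply/V0P; exists k.
Qed.

(** If the first letters differ, [cell_meet] makes the inner point a corner and [Fword_V0] pulls
    this back to [y]; if they agree, the common contraction cancels. *)
Lemma Fword_eq w w' y z : size w = size w' -> triangle q y -> triangle q z ->
  y \notin V0 q -> Fword F w y = Fword F w' z -> w = w' /\ y = z.
Proof.
elim: w w' => [|i w IH] [|j w'] //= [sw] Ty Tz Vy e.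
have [ij | [/V0P Vw _]] := cell_meet hn hq hF (Fword_triangle w Ty) (Fword_triangle w' Tz) e.
  rewrite -ij in e *; have [-> ->] // := IH w' sw Ty Tz Vy (cell_inj hn hF e).
by case/negP: Vy; apply: Fword_V0 Vw.
Qed.
End Words.

(** * Harmonic functions on cells *)

Section Harmonic.
Variables (R : realType) (n : nat) (q : 'I_3 -> 'rV[R]_2).
Variable F : 'I_(gasketN n).+1 -> 'rV[R]_2 -> 'rV[R]_2.
Hypotheses (hn : (2 <= n)%N) (hq : equilateral q) (hF : enumerates_contractions q F).
Variables (D : V0 q -> V0 q -> R) (r : 'I_(gasketN n).+1 -> R).
Hypotheses (hD : is_laplacian D) (r0 : forall i, 0 < r i).

(** The condition [balanced] in the plane: the neighbours of [p] are the other vertices of the cells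
    [F i] through [p]. *)
Definition cell_balanced (g : 'rV[R]_2 -> R) p : Prop :=
  (forall i k l, F i (q k) = p -> g (F i (q l)) = g p) \/
  ((exists i k l, F i (q k) = p /\ g p < g (F i (q l))) /\
   (exists i k l, F i (q k) = p /\ g (F i (q l)) < g p)).

(** Constants lie in the kernel of [D], so its rows sum to zero. *)
Lemma lapplyE u x : lapply D u x = \sum_(y | x != y) D x y * (u y - u x).
Proof.
have [_ _ /(_ (fun=> 1))[_ D1] _] := hD.
have := D1 (ex_intro (fun c => forall p : V0 q, 1 = c) 1 (fun=> erefl)) x.
rewrite /lapply (eq_bigr (D x)) => [D0|y _]; last by rewrite mulr1.
rewrite -[LHS]subr0 -[X in _ - X](mul0r (u x)) -[X in _ - X * _]D0 mulr_suml -sumrB.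
rewrite (bigD1 x) //= subrr add0r; apply: eq_big => [y|y _]; first by rewrite eq_sym.
by rewrite mulrBr.
Qed.

Hypothesis Dpos : forall x y, x != y -> 0 < D x y.

Lemma harmonic_cell_balanced K h w p :
  harmonic_function F D r K h -> (exists i k, p = F i (q k)) -> p \notin V0 q ->
  cell_balanced (h \o Fword F w) p.
Proof.
move=> [_ harm] [i0 [k0 pE]] pV0.
have Tp : triangle q p by rewrite pE; apply/cell_triangle/triangle_vertex.
pose m := (size w).+1.
have q_in k : q k \in V0 q by apply/V0P; exists k.
have szw i : size (rcons w i) == m by rewrite size_rcons.
pose ext i : m.-tuple 'I_(gasketN n).+1 := Tuple (szw i).
have extE i k : Fword F (ext i) (q k) = Fword F w (F i (q k)) by rewrite Fword_rcons.
pose P : Vm F q m := [` Fword_in_Vm F (ext i0) [` q_in k0]%fset]%fset.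
have PE : val P = Fword F w p by rewrite pE -extE.
have PV0 : val P \notin V0 q by rewrite PE; apply: contra pV0; apply: Fword_V0.
have := harm m isT P PV0; rewrite /Hm.
under eq_bigr => w' _.
  rewrite /Rword_tr mulr_sumr.
  under eq_bigr => x _ do rewrite lapplyE mulr_sumr.
  over.
rewrite pair_big_dep /= pair_big_dep /=.
rewrite (eq_bigr (fun t : m.-tuple 'I_(gasketN n).+1 * V0 q * V0 q =>
  ((rword r t.1.1)^-1 * D t.1.2 t.2) *
  (h (Fword F t.1.1 (val t.2)) - h (Fword F t.1.1 (val t.1.2))))); last first.
  by move=> t _; rewrite mulrA.
have c_gt0 (w' : seq 'I_(gasketN n).+1) x y : x != y -> 0 < (rword r w')^-1 * D x y.
  by move=> xy; rewrite mulr_gt0 ?Dpos // invr_gt0 prodr_gt0.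
(* Since [p] is not a corner, every cell of this level through [Fword F w p] sits inside the cell of
   [w]. *)
have decode (w' : m.-tuple 'I_(gasketN n).+1) (x : V0 q) :
    Fword F w' (val x) = Fword F (rcons w i0) (q k0) ->
    exists i k, [/\ w' = ext i, val x = q k & F i (q k) = p].
  have [k xk] := V0P _ _ (valP x).
  case: w' => w' sw'; case/lastP: w' sw' => // w' i sw'; rewrite xk /= !Fword_rcons -pE.
  have sw : size w = size w' by move: sw'; rewrite size_rcons eqSS => /eqP.
  move=> /esym /(Fword_eq hn hq hF sw Tp _ pV0)[].
    exact/cell_triangle/triangle_vertex.
  by move=> ww' pF; exists i, k; split=> //; apply: val_inj; rewrite /= ww'.
move=> /weighted_sum_eq0[t /andP[_ tt]|H|[pos neg]]; first exact/ltW/c_gt0.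
- left=> i k l Fp; have [<-|kl] := eqVneq k l; first by rewrite Fp.
  apply/eqP; rewrite /= -Fp -subr_eq0 -!extE; apply/eqP.
  have xy : [` q_in k]%fset != [` q_in l]%fset.
    by apply: contra kl => /eqP/(congr1 val)/=/(vertex_inj hq)/eqP.
  apply: (H (ext i, [` q_in k]%fset, [` q_in l]%fset)) => /=; last exact: c_gt0.
  by rewrite xy andbT !Fword_rcons Fp pE.
- right; split.
    have [[[w' x] y] /= [/andP[/eqP/decode[i [k [-> xk Fp]]] xy] _]] := pos.
    have [l yl] := V0P _ _ (valP y).
    by rewrite subr_gt0 xk yl !extE Fp => lt; exists i, k, l.
  have [[[w' x] y] /= [/andP[/eqP/decode[i [k [-> xk Fp]]] xy] _]] := neg.
  have [l yl] := V0P _ _ (valP y).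
  by rewrite subr_lt0 xk yl !extE Fp => lt; exists i, k, l.
Qed.
End Harmonic.

(** * Positivity of the conductances *)

Lemma third_index (a b : 'I_3) : a != b ->
  exists c : 'I_3, [/\ c != a, c != b & forall k, [|| k == a, k == b | k == c]].
Proof.
case: a b => [[|[|[|//]]] a3] [[|[|[|//]]] b3] //= _;
  [exists ord_max | exists 1 | exists ord_max | exists 0 | exists 1 | exists 0];
  by split=> //; apply: forall_ord3.
Qed.

Lemma quadratic_ge0_linear (R : realFieldType) (b c : R) :
  (forall t, 0 <= t * (b + t * c)) -> b = 0.
Proof.
move=> H; apply/eqP/negP => /negP b0.
have c0 : 0 < 1 + `|c| by rewrite ltr_pwDl.
(* The value at this [t] is negative because [c < 1 + |c|]. *)
have := H (- b / (1 + `|c|)).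
have -> : - b / (1 + `|c|) * (b + - b / (1 + `|c|) * c)
    = - (b ^+ 2) / (1 + `|c|) * (1 - c / (1 + `|c|)) by field; rewrite gt_eqF.
apply/negP; rewrite -ltNge mulNr mulNr oppr_lt0 mulr_gt0 //.
  by rewrite divr_gt0 // exprn_even_gt0.
by rewrite subr_gt0 ltr_pdivrMr // mul1r (le_lt_trans (ler_norm c)) // ltrDr.
Qed.

Section Positivity.
Variables (R : realType) (n : nat) (q : 'I_3 -> 'rV[R]_2).
Variable F : 'I_(gasketN n).+1 -> 'rV[R]_2 -> 'rV[R]_2.
Hypotheses (hn : (2 <= n)%N) (hq : equilateral q) (hF : enumerates_contractions q F).
Variables (D : V0 q -> V0 q -> R) (r : 'I_(gasketN n).+1 -> R).
Hypothesis hDr : harmonic_structure F D r.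

Lemma vertex_in_V0 k : q k \in V0 q.
Proof. by apply/V0P; exists k. Qed.

Definition V0_vertex k : V0 q := [` vertex_in_V0 k]%fset.

Definition V1_vertex i (x : V0 q) : Vm F q 1 := [` Fword_in_Vm F [tuple i] x]%fset.

Lemma V0_vertexP x : exists k, x = V0_vertex k.
Proof. by have [k xk] := V0P _ _ (valP x); exists k; apply: val_inj. Qed.

Lemma V0_vertex_inj : injective V0_vertex.
Proof. by move=> k l /(congr1 val)/(vertex_inj hq). Qed.

Lemma offset_vertex i a k : has_offset q F i a ->
  F i (q k) = bary q (fun l => n%:R^-1 * ((l == k) + a l)%N%:R).
Proof.
move=> ai; rewrite -bary_vertex (cell_bary _ ai).
by apply: eq_bigr => l _; rewrite natrD.
Qed.

Let D_ge0 x y : x != y -> 0 <= D x y.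
Proof. by case: hDr => [[_ _ _]] + _ _; apply. Qed.

Let D_sym x y : D x y = D y x.
Proof. by case: hDr => [[]]. Qed.

(** Were both conductances at [a] zero, the indicator of [a] would be a nonconstant function in the
    kernel of [D]. *)
Lemma conductance_other a b c : [/\ a != b, c != a & c != b] ->
  (forall k, [|| k == a, k == b | k == c]) ->
  D (V0_vertex a) (V0_vertex b) = 0 -> 0 < D (V0_vertex a) (V0_vertex c).
Proof.
move=> [ab ca cb] abc Dab.
rewrite lt_neqAle D_ge0 ?andbT; last by rewrite (inj_eq V0_vertex_inj) eq_sym.
apply/eqP => Dac; have [hD _ _] := hDr.
have D0 y : V0_vertex a != y -> D (V0_vertex a) y = 0.
  have [k ->] := V0_vertexP y; have /or3P[] := abc k => /eqP -> //.
  by rewrite eqxx.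
have [_ _ /(_ (fun x => (x == V0_vertex a)%:R))[ker _] _] := hD.
case: ker => [x|e e_const].
  rewrite (lapplyE hD) big1 // => y xy; have [xa|xa] := eqVneq x (V0_vertex a).
    by rewrite xa D0 ?mul0r // -xa.
  have [ya|ya] := eqVneq y (V0_vertex a); last by rewrite subrr mulr0.
  by rewrite ya D_sym D0 ?mul0r // eq_sym.
have := e_const (V0_vertex a); rewrite -(e_const (V0_vertex b)) eqxx.
by rewrite (inj_eq V0_vertex_inj) eq_sym (negPf ab) => /eqP; rewrite oner_eq0.
Qed.

Lemma E0_expand (u w : V0 q -> R) t :
  E0 D (fun x => u x + t * w x) (fun x => u x + t * w x)
  = E0 D u u + t * (2 * E0 D u w + t * E0 D w w).
Proof.
rewrite /E0 !pair_bigA /= !mulr_sumr -!big_split /= mulr_sumr -big_split /=.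
by apply: eq_bigr => x _; ring.
Qed.

Lemma E1_expand (u w : Vm F q 1 -> R) t :
  E1 D r (fun x => u x + t * w x) (fun x => u x + t * w x)
  = E1 D r u u + t * (2 * E1 D r u w + t * E1 D r w w).
Proof.
rewrite /E1 !mulr_sumr -!big_split /= mulr_sumr -big_split /=.
by apply: eq_bigr => i _; rewrite E0_expand; ring.
Qed.

(** First variation: along the direction [w] the excess energy is nonnegative for all [t] and zero
    at [t = 0], so its linear coefficient vanishes. *)
Lemma minimizer_E1 (u u' : V0 q -> R) (v w : Vm F q 1 -> R) :
  extends v u -> E1 D r v v = E0 D u u -> extends w u' -> E1 D r v w = E0 D u u'.
Proof.
move=> vu Evu wu'; have [_ _ min] := hDr.
suff : 2 * (E1 D r v w - E0 D u u') = 0.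
  by move/eqP; rewrite mulf_eq0 pnatr_eq0 /= subr_eq0 => /eqP.
apply: (@quadratic_ge0_linear R _ (E1 D r w w - E0 D u' u')) => t.
have [_ /(_ (fun x => v x + t * w x))] := min (fun x => u x + t * u' x).
rewrite E0_expand E1_expand Evu => H.
have /H : extends (fun x => v x + t * w x) (fun x => u x + t * u' x).
  by move=> p x px; rewrite (vu _ _ px) (wu' _ _ px).
rewrite -subr_ge0; congr (_ <= _); ring.
Qed.

Lemma E0_normr (u : V0 q -> R) : E0 D (fun x => `|u x|) (fun x => `|u x|) <= E0 D u u.
Proof.
apply: ler_sum => x _; apply: ler_sum => y _.
have [->|xy] := eqVneq x y; first by rewrite !subrr !mulr0.
rewrite -!mulrA ler_wpM2l ?D_ge0 //.
have sq a : `|a| * `|a| = a * a :> R by rewrite -normrM ger0_norm // -expr2 sqr_ge0.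
have := sq (u x); have := sq (u y); have := ler_norm (u x * u y); rewrite normrM; lra.
Qed.

(** The minimizer is tested against the indicator of the point. Since [v] is nonnegative and zero
    there, all terms of the pairing are nonpositive, while their sum is zero. *)
Lemma zero_set_spreads (u : V0 q -> R) (v : Vm F q 1 -> R) i x :
  extends v u -> E1 D r v v = E0 D u u -> (forall p, 0 <= v p) ->
  E0 D u (fun y => (val y == F i (val x))%:R) = 0 -> v (V1_vertex i x) = 0 ->
  forall y, x != y -> 0 < D x y -> v (V1_vertex i y) = 0.
Proof.
move=> vu Evu v0 Euw vx y xy Dxy; have [_ r_gt0 _] := hDr.
pose w (p : Vm F q 1) : R := (val p == F i (val x))%:R.
have := minimizer_E1 vu Evu (_ : extends w (fun y => (val y == F i (val x))%:R)).
rewrite Euw => /(_ _)E; have {E} : E1 D r v w = 0 by apply: E => p z; rewrite /w => ->.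
rewrite /E1 /E0.
under eq_bigr => j _ do rewrite mulr_sumr.
rewrite pair_bigA /=.
under eq_bigr => t _.
  rewrite mulr_sumr (bigD1 t.2) //= !subrr !mulr0 add0r.
  over.
rewrite pair_big_dep /=.
rewrite (eq_bigr (fun t : 'I_(gasketN n).+1 * V0 q * V0 q =>
  ((r t.1.1)^-1 * D t.1.2 t.2) * ((v (V1_vertex t.1.1 t.1.2) - v (V1_vertex t.1.1 t.2)) *
    (w (V1_vertex t.1.1 t.1.2) - w (V1_vertex t.1.1 t.2))))); last first.
  by move=> t _; rewrite !mulrA.
move=> /weighted_sum_eq0[t tt| H |[[t [_ _]] + _]].
- by rewrite mulr_ge0 ?D_ge0 1?eq_sym // invr_ge0 ltW.
- have := H (i, x, y); rewrite /= eq_sym xy => /(_ isT).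
  rewrite mulr_gt0 ?invr_gt0 // => /(_ isT).
  rewrite vx /w /= eqxx sub0r; case: eqP => [yx _|_].
    by rewrite -vx; congr v; apply: val_inj.
  by rewrite subr0 mulr1 => /eqP; rewrite oppr_eq0 => /eqP.
- have wv p : w p = 0 \/ w p = 1 /\ v p = 0.
    rewrite /w; case: eqP => [pE|_]; [right | by left].
    by split=> //; rewrite -vx; congr v; apply: val_inj.
  by case: (wv (V1_vertex t.1.1 t.1.2)) => [->|[-> ->]];
     case: (wv (V1_vertex t.1.1 t.2)) => [->|[-> ->]];
     have := v0 (V1_vertex t.1.1 t.1.2); have := v0 (V1_vertex t.1.1 t.2); lra.
Qed.

Lemma conductance_gt0 x y : x != y -> 0 < D x y.
Proof.
have [a ->] := V0_vertexP x; have [b ->] := V0_vertexP y.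
rewrite (inj_eq V0_vertex_inj) => ab; rewrite lt_neqAle D_ge0 ?andbT; last first.
  by rewrite (inj_eq V0_vertex_inj).
apply/eqP => /esym Dab; have [c [ca cb abc]] := third_index ab.
have Dac : 0 < D (V0_vertex a) (V0_vertex c) by apply: (@conductance_other a b c).
have Dbc : 0 < D (V0_vertex b) (V0_vertex c).
  apply: (@conductance_other b a c); [by split; rewrite // eq_sym | | by rewrite D_sym].
  by move=> k; have := abc k; rewrite orbCA.
have [_ r_gt0 min] := hDr.
pose u x : R := (x == V0_vertex a)%:R.
have [[v1 v1u E1u] _] := min u.
(* [|v1|] has the same boundary values and no more energy than [v1]. *)
pose v p := `|v1 p|.
have vu : extends v u.
  by move=> p z pz; rewrite /v (v1u _ _ pz) ger0_norm // ler0n.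
have Evu : E1 D r v v = E0 D u u.
  apply/eqP; rewrite eq_le (proj2 (min u)) // andbT E1u; apply: ler_sum => i _.
  by rewrite ler_wpM2l ?invr_ge0 ?(ltW (r_gt0 _)) // E0_normr.
have v_ge0 p : 0 <= v p by apply: normr_ge0.
(* On [V0 q] the indicator of [p] is zero or the indicator of [q b]. In the latter case nothing
   flows to [a], the conductance being zero, nor to [c], where [u] has the same value as at [b]. *)
have Euw p : p != q a -> p != q c -> E0 D u (fun y => (val y == p)%:R) = 0.
  move=> pa pc; rewrite /E0 big1 // => x1 _; rewrite big1 // => y1 _.
  have [k ->] := V0_vertexP x1; have [l ->] := V0_vertexP y1.
  have w0 m : m != b -> (val (V0_vertex m) == p) = false.
    move=> /negPf mb; have := abc m; rewrite mb /= => /orP[] /eqP ->;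
    by rewrite eq_sym; apply: negPf.
  have [->|kb] := eqVneq k b; have [->|lb] := eqVneq l b; rewrite ?subrr ?mulr0 //.
  - have [->|la] := eqVneq l a; first by rewrite D_sym Dab !mul0r.
    by rewrite /u !(inj_eq V0_vertex_inj) (negPf la) eq_sym (negPf ab) subrr mulr0 mul0r.
  - have [->|ka] := eqVneq k a; first by rewrite Dab !mul0r.
    by rewrite /u !(inj_eq V0_vertex_inj) (negPf ka) eq_sym (negPf ab) subrr mulr0 mul0r.
  - by rewrite !w0 // subrr mulr0.
have spread i k l : F i (q k) != q a -> F i (q k) != q c ->
    0 < D (V0_vertex k) (V0_vertex l) -> k != l ->
    v (V1_vertex i (V0_vertex k)) = 0 -> v (V1_vertex i (V0_vertex l)) = 0.
  move=> ka kc Dkl kl vk; apply: (zero_set_spreads vu Evu v_ge0 _ vk) => //.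
    exact: Euw.
  by rewrite (inj_eq V0_vertex_inj).
(* [off s], for [s < n], runs through the cells on the side from [q b] to [q a]. *)
pose off s (k : 'I_3) := if k == a then s else if k == b then (n.-1 - s)%N else 0%N.
have ba : b == a = false by rewrite eq_sym (negPf ab).
have sum_off s : (s < n)%N -> (\sum_(k < 3) off s k = n.-1)%N.
  move=> sn; rewrite (bigD1 a) //= (bigD1 b) ?ba //= big1 => [|k /andP[ka kb]].
    by rewrite /off eqxx ba eqxx; lia.
  by rewrite /off (negPf ka) (negPf kb).
have n_neq0R : n%:R != 0 :> R by rewrite pnatr_eq0; lia.
(* With no conductance between [b] and [a], zeros pass through [c]. As [off s] vanishes at [c] and
   [n >= 2], the point [F i (q c)] differs from [q c], so [spread] applies there. *)
have hop s i : (s < n)%N -> has_offset q F i (off s) ->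
    v (V1_vertex i (V0_vertex b)) = 0 -> v (V1_vertex i (V0_vertex a)) = 0.
  move=> sn ioff vb.
  have neq k m : k != m -> F i (q k) != q m.
    apply: contra => /eqP /(cell_vertex hn hq hF (triangle_vertex q k)).
    by move=> /(vertex_inj hq) ->.
  have vc : v (V1_vertex i (V0_vertex c)) = 0.
    by apply: (spread i b); rewrite ?neq // eq_sym.
  apply: (spread i c) => //; [exact: neq | | by rewrite D_sym].
  apply/eqP; rewrite -bary_vertex (cell_bary _ ioff) => /(bary_inj hq) H.
  have {H} /(_ c) : (fun k => n%:R^-1 * (vertex R c k + (off s k)%:R)) =1 vertex R c.
    apply: H; rewrite (sum_cell hn); [|exact: sum_off|exact: simplex_vertex].
    by case: (simplex_vertex R c).
  rewrite /off /vertex eqxx (negPf ca) (negPf cb) addr0 mulr1 => n1.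
  have : n%:R = 1 :> R by rewrite -[n%:R]invrK n1 invr1.
  by move/eqP; rewrite pnatr_eq1; lia.
(* The vertex [a] of cell [s] is the vertex [b] of cell [s.+1]; the chain starts at [q b], where [u]
   is 0. *)
have zigzag s i : (s < n)%N -> has_offset q F i (off s) ->
    v (V1_vertex i (V0_vertex b)) = 0.
  elim: s i => [|s IH] i sn ioff.
    rewrite (vu _ (V0_vertex b)) /u ?(inj_eq V0_vertex_inj) ?ba //=.
    rewrite (offset_vertex _ ioff) -[RHS]bary_vertex; apply: eq_bigr => l _.
    congr (_ *: _); rewrite /off /vertex; have [->|la] := eqVneq l a.
      by rewrite (negPf ab) mulr0.
    have [_|lb] := eqVneq l b; last by rewrite mulr0.
    by rewrite subn0 add1n prednK ?mulVf //; lia.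
  have [j joff] := offset_cell hF (sum_off s (ltnW sn)).
  rewrite -(hop s j (ltnW sn) joff (IH j (ltnW sn) joff)); congr v; apply: val_inj => /=.
  rewrite (offset_vertex _ ioff) (offset_vertex _ joff); apply: eq_bigr => l _.
  congr (_ *: _); congr (_ * _%:R); rewrite /off; have [->|la] := eqVneq l a.
    by rewrite (negPf ab).
  by have [_|lb] := eqVneq l b => //; lia.
(* The last cell of the chain contains [q a], where [u] is 1. *)
have n1n : (n.-1 < n)%N by lia.
have [i ioff] := offset_cell hF (sum_off _ n1n).
have := hop _ i n1n ioff (zigzag _ i n1n ioff).
rewrite (vu _ (V0_vertex a)) /u ?eqxx; first by move/eqP; rewrite oner_eq0.
rewrite /= (offset_vertex _ ioff) -[RHS]bary_vertex; apply: eq_bigr => l _.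
congr (_ *: _); rewrite /off /vertex; have [_|la] := eqVneq l a.
  by rewrite add1n prednK ?mulVf //; lia.
by rewrite subnn; case: ifP; rewrite mulr0.
Qed.
End Positivity.

(** * The first graph approximation as a lattice *)

Section LatticePoints.
Variables (R : realType) (n : nat) (q : 'I_3 -> 'rV[R]_2).
Variable F : 'I_(gasketN n).+1 -> 'rV[R]_2 -> 'rV[R]_2.
Hypotheses (hn : (2 <= n)%N) (hq : equilateral q) (hF : enumerates_contractions q F).
Implicit Types (x y : nat * nat) (k l : 'I_3).

(** Lattice coordinates count [n]-ths of [q 0] and [q 1]; the origin is the corner [q ord_max]. *)
Definition lattice_weights x k : nat := nth 0%N [:: x.1; x.2; n - (x.1 + x.2)]%N k.

Definition lattice_point x : 'rV[R]_2 :=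
  bary q (fun k => n%:R^-1 * (lattice_weights x k)%:R).

Definition triangle_vertex_index x k : nat * nat :=
  ((k == 0%R) + x.1, (k == 1%R) + x.2)%N.

Let nR : n%:R != 0 :> R. Proof. by rewrite pnatr_eq0; lia. Qed.

Lemma lattice_point_inj x y : (x.1 + x.2 <= n)%N -> (y.1 + y.2 <= n)%N ->
  lattice_point x = lattice_point y -> x = y.
Proof.
move=> xn yn /(bary_inj hq) H.
have sumw z : (z.1 + z.2 <= n)%N ->
    \sum_(k < 3) n%:R^-1 * (lattice_weights z k)%:R = 1 :> R.
  move=> zn; rewrite -mulr_sumr -natr_sum sum3 /lattice_weights /=.
  by rewrite [(_ + _ + _)%R]subnKC // mulVf.
have {}H k : lattice_weights x k = lattice_weights y k.
  have := H _ k; rewrite !sumw // => /(_ erefl) /(mulfI _) e.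
  by apply/eqP; rewrite -(eqr_nat R) e // invr_eq0.
by have := H 0; have := H 1; rewrite /lattice_weights /=; case: x y {xn yn H} => ? ? [? ?] /= -> ->.
Qed.

Lemma corner_point k : lattice_point ((k == 0%R) * n, (k == 1%R) * n)%N = q k.
Proof.
rewrite -[RHS]bary_vertex; apply: eq_bigr => l _; congr (_ *: _).
rewrite /lattice_weights /vertex; move: k l; apply: forall_ord3; apply: forall_ord3 => /=;
  by rewrite ?mul1n ?mul0n ?addn0 ?add0n ?subnn ?subn0 ?mulr0 ?mulVf.
Qed.

Lemma cell_lattice_point i a k : has_offset q F i a ->
  F i (q k) = lattice_point (triangle_vertex_index (a 0, a 1) k).
Proof.
move=> ai; rewrite (offset_vertex _ ai); have [sa _] := ai.
apply: eq_bigr => l _; congr (_ *: _); congr (_ * _%:R).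
move: sa; rewrite sum3 /lattice_weights /triangle_vertex_index => sa.
move: k l; apply: forall_ord3; apply: forall_ord3 => //=; move: sa => /=; lia.
Qed.

Lemma lattice_nbrsP x y : (x.1 + x.2 <= n)%N -> reflect
  (exists z k l, [/\ (z.1 + z.2 < n)%N, k != l, x = triangle_vertex_index z k
                   & y = triangle_vertex_index z l])
  (y \in lattice_nbrs n x).
Proof.
case: x => i j /= ijn; apply: (iffP idP) => [|[[a b] [k [l [abn kl [-> ->] ->]]]]].
  rewrite !mem_cat => /or3P[]; case: ifP => // H; rewrite !inE => /orP[] /eqP ->.
  - by exists (i, j), ord_max, 0.
  - by exists (i, j), ord_max, 1.
  - by exists (i.-1, j), 0, 1; rewrite /triangle_vertex_index /= !add1n prednK //;
      split=> //; lia.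
  - by exists (i.-1, j), 0, ord_max; rewrite /triangle_vertex_index /= !add1n prednK //;
      split=> //; lia.
  - by exists (i, j.-1), 1, ord_max; rewrite /triangle_vertex_index /= !add1n prednK //;
      split=> //; lia.
  - by exists (i, j.-1), 1, 0; rewrite /triangle_vertex_index /= !add1n prednK //;
      split=> //; lia.
move: k l kl abn => [[|[|[|//]]] ?] [[|[|[|//]]] ?] //= _ abn;
  rewrite /triangle_vertex_index /= !mem_cat /=.
all: rewrite ?add0n ?add1n /=.
all: try by rewrite abn !inE eqxx ?orbT.
all: by rewrite !inE eqxx ?orbT.
Qed.

(** Cells are the upward triangles and [V0 q] the lattice corners, so the two notions of neighbour
    coincide. *)
Lemma lattice_balanced (g : 'rV[R]_2 -> R) :
  (forall p, (exists i k, p = F i (q k)) -> p \notin V0 q -> cell_balanced q F g p) ->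
  forall x, noncorner n x -> balanced n (g \o lattice_point) x.
Proof.
move=> bal x nx.
have xn : (x.1 + x.2 <= n)%N by case/and4P: nx.
have cellP z : (z.1 + z.2 < n)%N -> exists i, forall k,
    F i (q k) = lattice_point (triangle_vertex_index z k).
  move=> zn; pose a (k : 'I_3) := nth 0%N [:: z.1; z.2; n.-1 - (z.1 + z.2)]%N k.
  have [|i ia] := @offset_cell _ _ _ _ hF a; first by rewrite sum3 /a /=; lia.
  by exists i => k; rewrite (cell_lattice_point _ ia) /a /=; case: (z).
have nbr i k l : F i (q k) = lattice_point x -> k != l -> exists2 y, y \in lattice_nbrs n x
    & F i (q l) = lattice_point y.
  have [a ia] := offset_exists hF i; rewrite !(cell_lattice_point _ ia).
  have an : (a 0%R + a 1%R < n)%N by have [] := ia; rewrite sum3 /=; lia.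
  move=> /lattice_point_inj e kl; exists (triangle_vertex_index (a 0, a 1) l) => //.
  apply/lattice_nbrsP => //; exists (a 0, a 1), k, l; split=> //.
  rewrite e //; rewrite /triangle_vertex_index /=; move: an.
  by move: k {e kl}; apply: forall_ord3 => /=; lia.
have [] := bal (lattice_point x).
- case: x xn nx {nbr} => [[|i] j] /= xn nx.
    case: j xn nx => [|j] xn; rewrite /noncorner /= ?ltnn ?andbF // => /and3P[_ _ jn].
    have [|i iE] := cellP (0, j)%N; first by rewrite /=; lia.
    by exists i, 1; rewrite iE.
  have [i' iE] := cellP (i, j) xn.
  by exists i', 0; rewrite iE.
- apply/negP => /V0P[k]; rewrite -corner_point => /lattice_point_inj xk.
  have cn : ((k == 0%R) * n + (k == 1%R) * n <= n)%N.
    by move: k {xk}; apply: forall_ord3; rewrite /= ?mul1n ?mul0n ?addn0.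
  move: nx; rewrite xk // /noncorner /=.
  by case: (k == 0); case: (k == 1); rewrite ?mul1n ?mul0n ?ltnn ?andbF.
- move=> flat; rewrite /balanced; apply/orP; left; apply/allP => y.
  move=> /(lattice_nbrsP _ xn)[z [k [l [zn kl xE yE]]]]; have [i iE] := cellP z zn.
  by rewrite /= yE -iE (flat i k l) // iE -xE.
- move=> [[i [k [l [Fk lt]]]] [i' [k' [l' [Fk' lt']]]]].
  apply/orP; right; apply/andP; split; apply/hasP.
    have [kl|kl] := eqVneq k l; first by move: lt; rewrite -kl Fk ltxx.
    by have [y yx yE] := nbr _ _ _ Fk kl; exists y; rewrite //= -yE.
  have [kl|kl] := eqVneq k' l'; first by move: lt'; rewrite -kl Fk' ltxx.
  by have [y yx yE] := nbr _ _ _ Fk' kl; exists y; rewrite //= -yE.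
Qed.
End LatticePoints.

(** * From the vertices to the gasket *)

Section Attractor.
Variables (R : realType) (n : nat) (q : 'I_3 -> 'rV[R]_2).
Variable F : 'I_(gasketN n).+1 -> 'rV[R]_2 -> 'rV[R]_2.
Hypotheses (hn : (2 <= n)%N) (hq : equilateral q) (hF : enumerates_contractions q F).
Variable K : set 'rV[R]_2.
Hypothesis hK : is_attractor F K.

Lemma Fword_sub w y z : Fword F w y - Fword F w z = n%:R^-1 ^+ size w *: (y - z).
Proof.
elim: w => [|i w IH]; first by rewrite expr0 scale1r.
have [a [_ iE]] := offset_exists hF i.
by rewrite /= !iE -scalerBr opprD addrACA subrr addr0 IH scalerA exprS.
Qed.

Lemma Fword_attractor w y : K y -> K (Fword F w y).
Proof.
move=> Ky; elim: w => //= i w IH; have [_ _ ->] := hK.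
by exists i => //; exists (Fword F w y).
Qed.

Lemma attractor_Fword m x : K x -> exists w, size w = m /\ (Fword F w @` K) x.
Proof.
elim: m x => [|m IH] x Kx; first by exists [::]; split=> //; exists x.
have [_ _ KE] := hK; move: Kx; rewrite {1}KE => -[i _ [y Ky <-]].
by have [w [wm [z Kz <-]]] := IH y Ky; exists (i :: w); rewrite /= wm; split=> //; exists z.
Qed.

Lemma shrink (C e : R) : 0 < e -> exists m, n%:R^-1 ^+ m * C < e.
Proof.
move=> e0; have nV : `|n%:R^-1 : R| < 1.
  by rewrite ger0_norm ?invr_ge0 // invf_lt1 ?ltr1n // ltr0n; lia.
have /cvgr_dist_lt /(_ e e0) [m _ /(_ m (leqnn m))] := @cvg_geometric R C _ nV.
rewrite /= sub0r normrN => lt; exists m; apply: le_lt_trans lt.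
by rewrite mulrC ler_norm.
Qed.

(** The corner [q k] is the fixed point of the contraction at that corner; iterates of any point of
    [K] converge to it, and [K] is closed. *)
Lemma attractor_vertex k : K (q k).
Proof.
have [[y Ky] Kc _] := hK.
have [|i ik] := @offset_cell _ _ _ _ hF (fun l => (l == k) * n.-1)%N.
  by rewrite -big_distrl /= (bigD1 k) //= eqxx big1 ?mul1n // => l /negPf ->.
have fix_k m : Fword F (nseq m i) (q k) = q k.
  elim: m => //= m ->; rewrite (offset_vertex _ ik) -[RHS]bary_vertex.
  apply: eq_bigr => l _; congr (_ *: _); rewrite /vertex.
  case: eqP => _ /=; last by rewrite mulr0.
  by rewrite mul1n add1n prednK ?mulVf ?pnatr_eq0 //; lia.
apply: (compact_closed (@norm_hausdorff _ _) Kc) => B /nbhs_ballP[e /= e0 eB].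
have [m lt] := shrink `|y - q k| e0.
exists (Fword F (nseq m i) y); split; first exact: Fword_attractor.
apply: eB; rewrite -ball_normE /= distrC -[X in _ - X](fix_k m) Fword_sub size_nseq.
by rewrite normrZ ger0_norm // exprn_ge0 // invr_ge0.
Qed.

(** Every point of [K] lies in arbitrarily small cells, so the points [Fword F w (q k)] are dense in
    [K] and continuity suffices. *)
Lemma constant_of_vertices (h : 'rV[R]_2 -> R) c : {within K, continuous h} ->
  (forall w k, h (Fword F w (q k)) = c) -> forall x, K x -> h x = c.
Proof.
move=> /subspace_continuousP hc hV x Kx; have [_ Kc _] := hK.
have [M M0 KM] := ex_strict_bound_gt0 (compact_bounded Kc).
apply/eqP; rewrite -subr_eq0 -normr_eq0; apply/negP => /negP ne.
have e0 : 0 < `|h x - c| by rewrite lt_neqAle eq_sym ne normr_ge0.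
have := hc x Kx => /cvgr_dist_lt /(_ _ e0); rewrite near_withinE => /nbhs_ballP[d /= d0 xd].
have [m lt] := shrink (M + M) d0.
have [w [wm [y Ky xE]]] := attractor_Fword m Kx.
have Kw : K (Fword F w (q 0)) by apply/Fword_attractor/attractor_vertex.
suff /xd/(_ Kw) : ball x d (Fword F w (q 0)) by rewrite /from_subspace hV ltxx.
rewrite -ball_normE /= -xE Fword_sub wm normrZ ger0_norm ?exprn_ge0 ?invr_ge0 //.
apply: le_lt_trans lt; rewrite ler_wpM2l ?exprn_ge0 ?invr_ge0 //.
apply: le_trans (ler_normB _ _) _; apply: lerD; apply: ltW; apply: KM => //.
exact: attractor_vertex.
Qed.
End Attractor.

(** * Constancy passes between a cell and its subcells *)

Section Nondegenerate.
Variables (R : realType) (n : nat) (q : 'I_3 -> 'rV[R]_2).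
Variable F : 'I_(gasketN n).+1 -> 'rV[R]_2 -> 'rV[R]_2.
Hypotheses (hn : (2 <= n)%N) (hq : equilateral q) (hF : enumerates_contractions q F).
Variable g : 'rV[R]_2 -> R.
Hypothesis bal : forall p, (exists i k, p = F i (q k)) -> p \notin V0 q -> cell_balanced q F g p.

Lemma constant_of_boundary c : (forall k, g (q k) = c) -> forall i k, g (F i (q k)) = c.
Proof.
move=> gc i k; have [a ia] := offset_exists hF i; rewrite (cell_lattice_point hn _ ia).
have v_bal := lattice_balanced hn hq hF bal.
have corner (l : 'I_3) : g (lattice_point n q ((l == 0%R) * n, (l == 1%R) * n)%N) = c.
  by rewrite (corner_point q hn).
apply: (balanced_constant v_bal).
- by have := corner ord_max; rewrite /= !mul0n.
- by have := corner 0; rewrite /= mul0n mul1n.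
- by have := corner 1; rewrite /= mul0n mul1n.
have [+ _] := ia; rewrite sum3 /=; move: k; apply: forall_ord3 => /=; lia.
Qed.

(** The cell is a flat triangle of the lattice, so rigidity reaches the three corners. *)
Lemma constant_of_cell i c : (forall k, g (F i (q k)) = c) -> forall k, g (q k) = c.
Proof.
move=> gc k; have [a ia] := offset_exists hF i.
have an : (a 0%R + a 1%R < n)%N by have [] := ia; rewrite sum3 /=; lia.
have v_bal := lattice_balanced hn hq hF bal.
rewrite -(corner_point q hn); apply: (flat_triangle_constant v_bal an).
  move=> y; rewrite !inE => /or3P[] /eqP ->.
  - by have := gc ord_max; rewrite (cell_lattice_point hn _ ia).
  - by have := gc 0; rewrite (cell_lattice_point hn _ ia).
  - by have := gc 1; rewrite (cell_lattice_point hn _ ia).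
by move: k; apply: forall_ord3; rewrite /= ?mul0n ?mul1n ?addn0.
Qed.
End Nondegenerate.

Local Close Scope classical_set_scope.

Theorem theorem1p1 (R : realType) (n : nat) (hn : (2 <= n)%N)
  (q : 'I_3 -> 'rV[R]_2) (hq : equilateral q)
  (F : 'I_(gasketN n).+1 -> 'rV[R]_2 -> 'rV[R]_2)
  (hF : enumerates_contractions q F)
  (SG : set 'rV[R]_2) (hSG : is_attractor F SG)
  (D : V0 q -> V0 q -> R) (r : 'I_(gasketN n).+1 -> R)
  (hDr : harmonic_structure F D r) :
  nondegenerate_structure F D r SG.
Proof.
move=> [h [w [harm nconst [c hc]]]]; have [hD r_gt0 _] := hDr.
have bal w' p := @harmonic_cell_balanced _ _ _ _ hn hq hF _ _ hD r_gt0
  (conductance_gt0 hn hq hF hDr) SG h w' p harm.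
apply: nconst; exists c; apply: (constant_of_vertices hn hF hSG); first by case: harm.
(* Dropping the letters of [w] from the end, one at a time, enlarges the flat cell until its
   vertices are those of [V0 q]. *)
have boundary k : h (q k) = c.
  have hw l : h (Fword F w (q l)) = c.
    by apply: hc; exists (q l) => //; apply: (attractor_vertex hn hF hSG).
  elim/last_ind: w {hc} hw k => [|w i IH] hw k; first exact: hw.
  apply: IH; apply: (constant_of_cell hn hq hF (@bal w) (i := i)) => l /=.
  by rewrite -Fword_rcons.
(* Appending letters carries the constant back down to the vertices of every cell. *)
move=> w'; elim/last_ind: w' => [//|w' i IH] k; rewrite Fword_rcons.
exact: (constant_of_boundary hn hq hF (@bal w')).
Qed.
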